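(* Let $T$ be a densely defined positive symmetric operator in the real or complex Hilbert space $\mathcal H$. The following statements are equivalent: (i) $T$ has a unique positive self-adjoint extension, i.e., $T_N=T_F$; (ii) $\ker(I+T^* )\cap\mathcal D_*(T)=\{0\}$; (iii) for every non-zero vector $g\in\ker(I+T^* )$ one has $$\sup\{|\langle f,g\rangle|^2:\ f\in\operatorname{dom}T,\ \langle Tf,f\rangle\le1\}=+\infty.$$
   Context: A linear operator $T:\mathcal H\to\mathcal H$ is a linear map from a linear subspace $\operatorname{dom}T\subseteq\mathcal H$ into $\mathcal H$. It is symmetric if $\langle Tf,g\rangle=\langle f,Tg\rangle$ for all $f,g\in\operatorname{dom}T$, positive if symmetric with $\langle Tf,f\rangle\ge0$ for $f\in\operatorname{dom}T$, and self-adjoint if densely defined with $T^*=T$. Further, $$\mathcal D_*(T):=\Big\{g\in\mathcal H:\ \sup\{|\langle Th,g\rangle|^2: h\in\operatorname{dom}T,\ \langle Th,h\rangle\le1\}<+\infty\Big\}.$$ $T_N$ (the Krein-von Neumann extension) and $T_F$ (the Friedrichs extension) are the smallest and the largest positive self-adjoint extensions of $T$ with respect to the form order: $S_1\preceq S_2$ iff $(I+S_2)^{-1}\le(I+S_1)^{-1}$ for positive self-adjoint $S_1,S_2$. Concretely, let $\mathcal E_T$ be the completion of $\operatorname{ran}T$ under the inner product $\langle Tf,Th\rangle_{\mathcal E}:=\langle Tf,h\rangle$; let $J_T:\mathcal E_T\to\mathcal H$, $\operatorname{dom}J_T=\operatorname{ran}T$, $J_T(Th):=Th$, and $Q_T:\mathcal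 H\to\mathcal E_T$, $\operatorname{dom}Q_T=\operatorname{dom}T$, $Q_Tf:=Tf$ (both densely defined and closable). Then $T_N=J_T^{**}J_T^*$ and $T_F=Q_T^*Q_T^{**}$. *)

(* Defs.v *)
From mathcomp Require Import all_boot all_order all_algebra.
From mathcomp Require Import sesquilinear complex.
From mathcomp Require Import all_classical all_reals all_analysis.

Set Implicit Arguments.
Unset Strict Implicit.
Unset Printing Implicit Defensive.

Import Order.TTheory GRing.Theory Num.Theory.
Import numFieldNormedType.Exports.

Local Open Scope classical_set_scope.
Local Open Scope ring_scope.

Inductive scalar_kind := RealScalars | ComplexScalars.

Definition scalar (R : realType) (k : scalar_kind) : numFieldType :=
  match k with RealScalars => R | ComplexScalars => R[i] end.

Definition sconj (R : realType) (k : scalar_kind) : scalar R k -> scalar R k :=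
  match k return scalar R k -> scalar R k with
  | RealScalars => idfun
  | ComplexScalars => @Num.conj R[i]
  end.

Definition sqmod (R : realType) (k : scalar_kind) : scalar R k -> R :=
  match k return scalar R k -> R with
  | RealScalars => fun x => `|x| ^+ 2
  | ComplexScalars => fun z => complex.Re `|z| ^+ 2
  end.

(* The form [{dot _ for _}] is linear in its first argument and conjugate
   linear in its second one. *)
Record hilbertType (R : realType) (k : scalar_kind) := Hilbert {
  hilbert_sort :> completeNormedModType (scalar R k) ;
  hdot : {dot hilbert_sort for @sconj R k} ;
  hdot_norm : forall x : hilbert_sort, `|x| ^+ 2 = hdot x x
}.

Notation "''[' x , y ]" := (hdot _ x y) : ring_scope.

(* A linear operator is represented by its graph, so equality of operators
   (domains included) is equality of sets, extension is inclusion, and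
   composition is the composition [B \; A] (first A, then B) of relations. *)
Section Operators.
Context (R : realType) (k : scalar_kind).
Implicit Types U V H E : hilbertType R k.

Definition linear_operator U V (A : set (U * V)) : Prop :=
  [/\ A (0, 0),
      forall (a : scalar R k) p q, A p -> A q ->
        A (a *: p.1 + q.1, a *: p.2 + q.2)
    & forall u v v', A (u, v) -> A (u, v') -> v = v'].

Definition dom U V (A : set (U * V)) : set U := fst @` A.

Definition ran U V (A : set (U * V)) : set V := snd @` A.

Definition densely_defined U V (A : set (U * V)) : Prop := dense (dom A).

Definition symmetric H (T : set (H * H)) : Prop :=
  forall f Tf g Tg, T (f, Tf) -> T (g, Tg) -> '[Tf, g] = '[f, Tg].

Definition positive H (T : set (H * H)) : Prop :=
  symmetric T /\ forall f Tf, T (f, Tf) -> 0 <= '[Tf, f].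

(* For a densely defined A this is the graph of the operator A^*. *)
Definition adjoint U V (A : set (U * V)) : set (V * U) :=
  [set p | forall u v, A (u, v) -> '[v, p.1] = '[u, p.2]].

Definition self_adjoint H (T : set (H * H)) : Prop :=
  densely_defined T /\ adjoint T = T.

Definition positive_self_adjoint_extension H (T S : set (H * H)) : Prop :=
  [/\ linear_operator S, positive S, self_adjoint S & T `<=` S].

(* ker (I + A) *)
Definition ker_add1 H (A : set (H * H)) : set H :=
  [set g | exists2 Ag, A (g, Ag) & g + Ag = 0].

(* the pairs (f, Tf) with <Tf, f> <= 1 *)
Definition energy_ball H (T : set (H * H)) : set (H * H) :=
  [set p | T p /\ '[p.2, p.1] <= 1].

Definition Dstar H (T : set (H * H)) : set H :=
  [set g | (ereal_sup [set (sqmod '[p.2, g])%:E | p in energy_ball T] < +oo)%E].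

(* (E, j) is the completion of ran T for <Tf, Th>_E := <Tf, h>; the values of
   j outside ran T are irrelevant. *)
Definition energy_completion H (T : set (H * H)) E (j : H -> E) :
    Prop :=
  [/\ forall (a : scalar R k) x y, ran T x -> ran T y ->
        j (a *: x + y) = a *: j x + j y,
      forall f Tf h Th, T (f, Tf) -> T (h, Th) -> '[j Tf, j Th] = '[Tf, h]
    & dense (j @` ran T)].

Definition J_ H (T : set (H * H)) E (j : H -> E) : set (E * H) :=
  [set (j y, y) | y in ran T].

Definition Q_ H (T : set (H * H)) E (j : H -> E) : set (H * E) :=
  [set (p.1, j p.2) | p in T].

Local Open Scope relation_scope.

Definition krein_von_neumann H (T : set (H * H)) E (j : H -> E) :
    set (H * H) :=
  adjoint (adjoint (J_ T j)) \; adjoint (J_ T j).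

Definition friedrichs H (T : set (H * H)) E (j : H -> E) : set (H * H) :=
  adjoint (Q_ T j) \; adjoint (adjoint (Q_ T j)).

End Operators.

(* Main.v *)
(* Since J <= Q^*, both T_N = J^** J^* and T_F = Q^* Q^** are of the form B^* B with
   B closed, and B = Q^** is a restriction of B = J^*.  The complement of the graph
   of Q^** in that of J^* consists of the pairs (g, J^* g) with T^* g = - g, and
   dom J^* = D_*(T) by Riesz representation.  If this complement is trivial, then
   Q^** = J^*, and any positive self-adjoint extension S of T satisfies
   dom S <= D_*(T) by Cauchy-Schwarz for the form of S; thus S <= T_F, with equality
   because both are self-adjoint.  Conversely, if T_N = T_F, (g, J^* g) is in the
   complement and h = (I + T_F)^-1 g, then
   <g, g> = <g, h> + <J^* g, Q^** h> = <g, h> - <g, h> = 0.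
   The Riesz representation and projection theorems are both obtained by minimizing
   |u|^2 + |v|^2 - 2 Re c over a subspace of triples (u, v, c). *)
Require Import Defs.
From mathcomp Require Import all_boot all_order all_algebra.
From mathcomp Require Import sesquilinear complex ring lra.
From mathcomp Require Import all_classical all_reals all_analysis.
Set Implicit Arguments.
Unset Strict Implicit.
Unset Printing Implicit Defensive.
Import Order.TTheory GRing.Theory Num.Theory.
Import numFieldNormedType.Exports.
Local Open Scope classical_set_scope.
Local Open Scope ring_scope.

(** For [r > 0] evaluate at the minimizer [t = - q / r]. For [r = 0] an affine function bounded
    below is constant, so [q = 0]. Every Cauchy-Schwarz estimate below comes from this discriminant
    bound. *)
Lemma quad_ge0_discr (R : realFieldType) (p q r : R) : 0 <= r ->
  (forall t, 0 <= p + 2 * t * q + t ^+ 2 * r) -> q ^+ 2 <= p * r.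
Proof.
rewrite le_eqVlt => /predU1P[<-|r0] pqr.
  have [->|q0] := eqVneq q 0; first by rewrite expr0n mulr0.
  have := pqr (- (p + 1) / (2 * q)).
  have -> : p + 2 * (- (p + 1) / (2 * q)) * q + (- (p + 1) / (2 * q)) ^+ 2 * 0 = -1.
    by field.
  by rewrite ler0N1.
have := pqr (- q / r).
have -> : p + 2 * (- q / r) * q + (- q / r) ^+ 2 * r = (p * r - q ^+ 2) / r.
  by field; rewrite gt_eqF.
by rewrite pmulr_lge0 ?invr_gt0// subr_ge0.
Qed.

(** * Real parts and squared moduli, uniformly for real and complex scalars *)

Section Scalars.
Context {R : realType} {k : scalar_kind}.
Local Notation K := (Defs.scalar R k).

Definition rpart : K -> R :=
  match k return Defs.scalar R k -> R with
  | RealScalars => idfun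
  | ComplexScalars => @complex.Re R
  end.

Definition of_real : R -> K :=
  match k return R -> Defs.scalar R k with
  | RealScalars => idfun
  | ComplexScalars => real_complex R
  end.

Lemma rpartD (x y : K) : rpart (x + y) = rpart x + rpart y.
Proof. by rewrite /rpart; move: x y; case: k => //= -[a b] [c d]. Qed.

Lemma rpartN (x : K) : rpart (- x) = - rpart x.
Proof. by rewrite /rpart; move: x; case: k => //= -[a b]. Qed.

Lemma rpart0 : rpart 0 = 0.
Proof. by rewrite /rpart; case: k. Qed.

Lemma rpartZ (t : R) (x : K) : rpart (of_real t * x) = t * rpart x.
Proof.
by rewrite /rpart /of_real; move: x; case: k => //= -[a b] /=; rewrite mul0r subr0.
Qed.

Lemma rpart_sconj (x : K) : rpart (sconj x) = rpart x.
Proof. by rewrite /rpart; move: x; case: k => //= -[a b]. Qed.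

Lemma rpart_of_real t : rpart (of_real t) = t.
Proof. by rewrite /rpart /of_real; case: k. Qed.

Lemma sconjM (x y : K) : sconj (x * y) = sconj x * sconj y.
Proof. by move: x y; case: k => // x y; exact: rmorphM. Qed.

Lemma sconjK (x : K) : sconj (sconj x) = x.
Proof. by move: x; case: k => // x; exact: conjCK. Qed.

Lemma sconj_of_real t : sconj (of_real t) = of_real t :> K.
Proof. by rewrite /of_real; case: k => //=; exact: conjc_real. Qed.

Lemma of_realM s t : of_real (s * t) = of_real s * of_real t :> K.
Proof. by rewrite /of_real; case: k => //=; exact: rmorphM. Qed.

Lemma of_real0 : of_real 0 = 0 :> K.
Proof. by rewrite /of_real; case: k. Qed.

Lemma of_real1 : of_real 1 = 1 :> K.
Proof. by rewrite /of_real; case: k. Qed.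

Lemma ler_of_real s t : (of_real s <= of_real t :> K) = (s <= t).
Proof. by rewrite /of_real; case: k => //=; exact: lecR. Qed.

Lemma ltr_of_real s t : (of_real s < of_real t :> K) = (s < t).
Proof. by rewrite /of_real; case: k => //=; exact: ltcR. Qed.

Lemma ge0_of_realE (x : K) : 0 <= x -> x = of_real (rpart x).
Proof.
rewrite /of_real /rpart; move: x; case: k => //= -[a b].
by rewrite lecE /= => /andP[/eqP -> _].
Qed.

Lemma mul_sconj (x : K) : x * sconj x = of_real (sqmod x).
Proof.
move: x; rewrite /of_real /sqmod; case: k => /= x.
  by rewrite -normrX ger0_norm ?sqr_ge0// expr2.
rewrite -normCK -add_Re2_Im2; congr _%:C%C; case: x => a b /=.
by rewrite sqr_sqrtr// addr_ge0// sqr_ge0.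
Qed.

Lemma sqmod_sconj (x : K) : sqmod (sconj x) = sqmod x.
Proof.
rewrite -[LHS](rpart_of_real (sqmod (sconj x))) -mul_sconj sconjK mulrC.
by rewrite mul_sconj rpart_of_real.
Qed.

Lemma sqmodM (x y : K) : sqmod (x * y) = sqmod x * sqmod y.
Proof.
rewrite -[LHS](rpart_of_real (sqmod (x * y))) -mul_sconj sconjM mulrACA.
by rewrite !mul_sconj -of_realM rpart_of_real.
Qed.

Lemma sqmod_of_real t : sqmod (of_real t : K) = t ^+ 2.
Proof.
rewrite -[LHS](rpart_of_real (sqmod (of_real t))) -mul_sconj sconj_of_real.
by rewrite -of_realM rpart_of_real expr2.
Qed.

Lemma rpart_ge0 (x : K) : 0 <= x -> 0 <= rpart x.
Proof. by move=> x0; rewrite -(@ler_of_real) of_real0 -ge0_of_realE. Qed.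

Lemma sqmod_ge0 (x : K) : 0 <= sqmod x.
Proof. by move: x; rewrite /sqmod; case: k => x; exact: sqr_ge0. Qed.

Lemma sqmodN (x : K) : sqmod (- x) = sqmod x.
Proof. by move: x; rewrite /sqmod; case: k => x; rewrite normrN. Qed.

Lemma sqmod_eq0 (x : K) : sqmod x = 0 -> x = 0.
Proof.
move=> x0; have /eqP := mul_sconj x; rewrite x0 of_real0 mulf_eq0 => /orP[/eqP//|].
move: x {x0}; case: k => x /=; first by move/eqP.
by rewrite conjC_eq0 => /eqP.
Qed.

Lemma sqr_rpart_le (x : K) : rpart x ^+ 2 <= sqmod x.
Proof.
move: x; rewrite /sqmod /rpart; case: k => /= x.
  by rewrite -normrX ger0_norm ?sqr_ge0.
by case: x => a b /=; rewrite sqr_sqrtr ?addr_ge0 ?sqr_ge0// lerDl sqr_ge0.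
Qed.

(** Taking [a] to be the conjugate of [x] gives the squared modulus. Equalities of scalars thus
    reduce to real parts whenever the data can be multiplied by any [a]. *)
Lemma rpart_eq0 (x : K) : (forall a, rpart (a * x) = 0) -> x = 0.
Proof.
by move=> /(_ (sconj x)); rewrite mulrC mul_sconj rpart_of_real => /sqmod_eq0.
Qed.

End Scalars.

(** * Inner products, density and completeness in terms of a real squared norm *)

Section InnerProduct.
Context {R : realType} {k : scalar_kind} {H : hilbertType R k}.
Local Notation K := (Defs.scalar R k).
Implicit Types x y z : H.

Lemma dotC x y : '[x, y] = sconj '[y, x].
Proof. by rewrite (@hermitian_subproof _ _ _ _ (hdot H)) expr0 mul1r. Qed.

Lemma dotDl x y z : '[x + y, z] = '[x, z] + '[y, z].
Proof. exact: linearDl. Qed.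

Lemma dotDr x y z : '[x, y + z] = '[x, y] + '[x, z].
Proof. exact: linearDr. Qed.

Lemma dotNl x y : '[- x, y] = - '[x, y].
Proof. exact: linearNl. Qed.

Lemma dotNr x y : '[x, - y] = - '[x, y].
Proof. exact: linearNr. Qed.

Lemma dot0l x : '[0, x] = 0.
Proof. exact: linear0l. Qed.

Lemma dot0r x : '[x, 0] = 0.
Proof. exact: linear0r. Qed.

Lemma dotZl (a : K) x y : '[a *: x, y] = a * '[x, y].
Proof. exact: linearZl_LR. Qed.

Lemma dotZr (a : K) x y : '[x, a *: y] = sconj a * '[x, y].
Proof. by rewrite dotC dotZl sconjM -dotC. Qed.

(** The squared norm as an element of [R], whereas the norm of the space takes its values in [K]. *)
Definition nsq x : R := rpart '[x, x].

Lemma dotxx x : '[x, x] = of_real (nsq x).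
Proof. by apply: ge0_of_realE; rewrite -hdot_norm exprn_ge0. Qed.

Lemma nsq_ge0 x : 0 <= nsq x.
Proof. by rewrite -(@ler_of_real _ k) of_real0 -dotxx -hdot_norm exprn_ge0. Qed.

Lemma nsq_eq0 x : nsq x = 0 -> x = 0.
Proof.
move=> x0; have /eqP := hdot_norm x.
by rewrite dotxx x0 of_real0 expf_eq0 /= normr_eq0 => /eqP.
Qed.

Lemma nsqD x y : nsq (x + y) = nsq x + 2 * rpart '[x, y] + nsq y.
Proof.
rewrite /nsq dotDl !dotDr !rpartD ['[y, x]]dotC rpart_sconj; ring.
Qed.

Lemma nsqZ (a : K) x : nsq (a *: x) = sqmod a * nsq x.
Proof. by rewrite /nsq dotZl dotZr mulrA mul_sconj rpartZ. Qed.

Lemma nsqN x : nsq (- x) = nsq x.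
Proof. by rewrite /nsq dotNl dotNr opprK. Qed.

Lemma nsq_realD (t : R) x y :
  nsq (x + of_real t *: y) = nsq x + 2 * t * rpart '[x, y] + t ^+ 2 * nsq y.
Proof.
by rewrite nsqD nsqZ sqmod_of_real dotZr sconj_of_real rpartZ mulrA.
Qed.

Lemma sqr_rpart_dot_le x y : rpart '[x, y] ^+ 2 <= nsq x * nsq y.
Proof.
apply: quad_ge0_discr; first exact: nsq_ge0.
by move=> t; rewrite -nsq_realD nsq_ge0.
Qed.

(** Multiplying [x] by the conjugate of ['[x, y]] makes the inner product real and equal to [sqmod
    '[x, y]]; one such factor then cancels from the real Cauchy-Schwarz inequality. *)
Lemma sqmod_dot_le x y : sqmod '[x, y] <= nsq x * nsq y.
Proof.
have := sqr_rpart_dot_le (sconj '[x, y] *: x) y.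
rewrite dotZl mulrC mul_sconj rpart_of_real nsqZ sqmod_sconj.
have := sqmod_ge0 '[x, y]; rewrite le_eqVlt => /predU1P[<- _|s0].
  by rewrite mulr_ge0// nsq_ge0.
by rewrite expr2 -mulrA ler_pM2l.
Qed.

Lemma norm_lt_of_real x (e : R) : 0 <= e -> (`|x| < of_real e) = (nsq x < e ^+ 2).
Proof.
move=> e0; rewrite -(@ltr_pXn2r _ 2)// ?nnegrE//; last by rewrite -of_real0 ler_of_real.
by rewrite hdot_norm dotxx expr2 -of_realM ltr_of_real -expr2.
Qed.

Lemma gt0_of_realE (e : K) : 0 < e -> exists2 r : R, 0 < r & e = of_real r.
Proof.
move=> e0; exists (rpart e); last exact/ge0_of_realE/ltW.
by rewrite -(@ltr_of_real _ k) of_real0 -ge0_of_realE// ltW.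
Qed.

Lemma dense_nsqP (D : set H) :
  dense D <-> forall x (e : R), 0 < e -> exists2 y, D y & nsq (x - y) < e.
Proof.
split=> [dD x e e0|dD O [x Ox] oO].
  have e'0 : 0 < of_real (Num.sqrt e) :> K by rewrite -of_real0 ltr_of_real sqrtr_gt0.
  have [|y [xy Dy]] := dD _ _ (ball_open x (of_real (Num.sqrt e))).
    by exists x; exact: ballxx.
  exists y => //; move: xy; rewrite -ball_normE /= norm_lt_of_real ?sqrtr_ge0//.
  by rewrite sqr_sqrtr// ltW.
have : nbhs x O by apply: open_nbhs_nbhs.
move=> /nbhs_ballP[e /= /gt0_of_realE[r r0 ->]] rO.
have [y Dy xy] := dD x _ (exprn_gt0 2 r0).
by exists y; split=> //; apply: rO; rewrite -ball_normE /= norm_lt_of_real// ltW.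
Qed.

(** By orthogonality [nsq (x - y) = nsq x + nsq y] for [y] in [D], so approximating [x] from [D]
    makes [nsq x] arbitrarily small. *)
Lemma dense_ortho_eq0 (D : set H) x :
  dense D -> (forall y, D y -> '[y, x] = 0) -> x = 0.
Proof.
move=> /dense_nsqP dD Dx; apply: nsq_eq0; apply/le_anti/andP; split; last exact: nsq_ge0.
apply/ler_addgt0Pr => e e0; rewrite add0r.
have [y /Dx xy0 /ltW xye] := dD x e e0; apply: le_trans xye.
rewrite nsqD nsqN dotNr rpartN dotC xy0 // rpart_sconj rpart0.
by rewrite oppr0 mulr0 addr0 lerDl nsq_ge0.
Qed.

Definition nsq_cvg (x_ : nat -> H) x :=
  forall e : R, 0 < e -> exists N, forall n, (N <= n)%N -> nsq (x_ n - x) < e.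

Lemma nsq_cauchy_cvg (x_ : nat -> H) :
  (forall e : R, 0 < e -> exists N, forall m n, (N <= m)%N -> (N <= n)%N ->
     nsq (x_ m - x_ n) < e) ->
  exists x, nsq_cvg x_ x.
Proof.
move=> xC; have : cvg (x_ @ \oo).
  apply: cauchy_cvg; apply/cauchyP => e /gt0_of_realE[r r0 ->].
  have [N NC] := xC _ (exprn_gt0 2 r0); exists (x_ N); exists N => //= n Nn.
  by rewrite -ball_normE /= norm_lt_of_real ?(ltW r0)//; apply: NC.
move=> /cvg_ex[x xx]; exists x => e e0.
have e'0 : 0 < of_real (Num.sqrt e) :> K by rewrite -of_real0 ltr_of_real sqrtr_gt0.
move/cvgrPdist_lt: xx => /(_ _ e'0)[N _ Nx]; exists N => n /Nx /=.
by rewrite distrC norm_lt_of_real ?sqrtr_ge0// sqr_sqrtr// ltW.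
Qed.

End InnerProduct.

(** * Elementary real inequalities for the limit arguments *)

Lemma sqr_sub3_le (R : realFieldType) (x y z : R) :
  (x - y - z) ^+ 2 <= 3 * (x ^+ 2 + (y ^+ 2 + z ^+ 2)).
Proof.
have := sqr_ge0 (x + y); have := sqr_ge0 (y - z); have := sqr_ge0 (x + z); nra.
Qed.

(** The last estimate of both limit arguments below: [X], [Y], [Z] are three squared errors and [a],
    [b] the squared norms of the test vectors. With [t = e / (6 * (a + b + 1))] the bound is [e];
    the summand 1 keeps this denominator positive. *)
Lemma mul3_sum_le (R : realFieldType) (X Y Z a b p q t d : R) :
  0 <= a -> 0 <= b -> 0 <= p -> 0 <= q ->
  X <= d * (a + b) -> Y <= p * a -> Z <= q * b -> d <= t -> p + q <= t ->
  3 * (X + (Y + Z)) <= 6 * t * (a + b + 1).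
Proof.
move=> a0 b0 p0 q0 Xd Yp Zq dt pqt.
have : d * (a + b) <= t * (a + b) by rewrite ler_wpM2r// addr_ge0.
have : p * a <= p * (a + b) by rewrite ler_wpM2l// lerDl.
have : q * b <= q * (a + b) by rewrite ler_wpM2l// lerDr.
have : (p + q) * (a + b) <= t * (a + b) by rewrite ler_wpM2r// addr_ge0.
lra.
Qed.

(** Divide [z ^+ 2 <= 2 * (x ^+ 2 + y ^+ 2) <= 2 * (a + b) * z] by [z], the case [z = 0] being
    trivial. *)
Lemma le_of_sqr_sub (R : realFieldType) (x y z a b : R) :
  0 <= z -> 0 <= a -> 0 <= b -> z = x - y ->
  x ^+ 2 <= a * z -> y ^+ 2 <= b * z -> z <= 2 * (a + b).
Proof.
rewrite le_eqVlt => /predU1P[<- a0 b0 _ _ _|z0 _ _ zE xa yb].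
  by rewrite mulr_ge0// addr_ge0.
rewrite -(ler_pM2r z0) {1}zE; have := sqr_ge0 (x + y).
have : (x - y) * z = (x - y) ^+ 2 by rewrite zE.
nra.
Qed.

Lemma double_le_add (R : realFieldType) (x y z : R) : 0 <= x -> 0 <= y ->
  z ^+ 2 <= x * y -> 2 * z <= x + y.
Proof.
move=> x0 y0 zxy; rewrite leNgt; apply/negP => h.
have : (x + y) * (x + y) < 2 * z * (2 * z) by apply: ltr_pM; lra.
by have := sqr_ge0 (x - y); nra.
Qed.

(** * Representation of a bounded functional on a subspace of a product *)

Section Riesz.
Context {R : realType} {k : scalar_kind} (U V : hilbertType R k).
Local Notation K := (Defs.scalar R k).
Context (D : set (U * V * K)) (C : R).
Hypothesis D0 : D (0, 0, 0).
Hypothesis D_lin : forall (a : K) u v c u' v' c', D (u, v, c) -> D (u', v', c') ->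
  D (a *: u + u', a *: v + v', a * c + c').
Hypothesis C_ge0 : 0 <= C.
Hypothesis D_bounded : forall u v c, D (u, v, c) ->
  rpart c ^+ 2 <= C * (nsq u + nsq v).

(** If [(x, w)] represents the functional, this is the squared distance to [(x, w)] up to a
    constant. *)
Let energy (p : U * V * K) := nsq p.1.1 + nsq p.1.2 - 2 * rpart p.2.

(* Half the derivative of [energy] at [p] in the direction [q]. *)
Let defect (p q : U * V * K) : R :=
  rpart '[p.1.1, q.1.1] + rpart '[p.1.2, q.1.2] - rpart q.2.

Let energy_lbound p : D p -> - C <= energy p.
Proof.
case: p => -[u v] c /D_bounded; rewrite /energy /=.
have s0 : 0 <= nsq u + nsq v by rewrite addr_ge0// nsq_ge0.
by move=> /(double_le_add C_ge0 s0); rewrite lerBrDr [- C + _]addrC lerBlDr addrC.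
Qed.

(** Moving from [p] by [t] times [q] changes the energy by [2 * t * defect p q + t ^+ 2 * (nsq q.1.1
    + nsq q.1.2)], which is at least [- e]; the discriminant bound applies. *)
Let defect_le p q (m e : R) : D p -> D q -> (forall p, D p -> m <= energy p) ->
  energy p <= m + e -> defect p q ^+ 2 <= e * (nsq q.1.1 + nsq q.1.2).
Proof.
case: p q => -[u v] c [[u' v'] c'] Dp Dq mD pm.
apply: quad_ge0_discr => [|t]; first by rewrite addr_ge0// nsq_ge0.
have := mD _ (D_lin (of_real t) Dq Dp); move: pm.
rewrite /energy /defect /= ![of_real t *: _ + _]addrC !nsq_realD.
by rewrite rpartD rpartZ; lra.
Qed.

(** A minimizing sequence is Cauchy, and its defects tend to 0, so its limit represents the
    functional. The first clause, approximation from [D], places the limit in [D] when the graph is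
    closed. *)
Lemma riesz_closure : exists x w,
  (forall e : R, 0 < e -> exists u v c,
     D (u, v, c) /\ nsq (u - x) + nsq (v - w) < e) /\
  forall u v c, D (u, v, c) -> '[u, x] + '[v, w] = c.
Proof.
pose A := [set energy p | p in D]; pose m : R := inf A.
have A_lb : has_lbound A by exists (- C) => _ [p Dp <-]; exact: energy_lbound.
have A_inf : has_inf A by split => //; exists (energy (0, 0, 0)); exists (0, 0, 0).
have m_le p : D p -> m <= energy p by move=> Dp; apply: ge_inf => //; exists p.
have /choice[p_ p_min] n : exists p, D p /\ energy p <= m + n.+1%:R^-1.
  have n0 : 0 < n.+1%:R^-1 :> R by rewrite invr_gt0.
  by have [_ [p Dp <-] /ltW pm] := inf_adherent n0 A_inf; exists p.
have p_defect n q : D q ->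
    defect (p_ n) q ^+ 2 <= n.+1%:R^-1 * (nsq q.1.1 + nsq q.1.2).
  by move=> Dq; have [Dp pm] := p_min n; exact: defect_le Dp Dq m_le pm.
have p_cauchy i j : nsq ((p_ i).1.1 - (p_ j).1.1) + nsq ((p_ i).1.2 - (p_ j).1.2)
    <= 2 * (i.+1%:R^-1 + j.+1%:R^-1).
  have [[Di _] [Dj _]] := (p_min i, p_min j).
  move: (p_defect i) (p_defect j) Di Dj; rewrite /defect.
  case: (p_ i) (p_ j) => -[u v] c [[u' v'] c'] /= di dj Di Dj.
  (* Both defects are tested against the difference of the two triples. Subtracting them cancels the
     scalar part and leaves the squared distance. *)
  have Dij := D_lin (- 1) Dj Di.
  rewrite !scaleN1r mulN1r ![- _ + _]addrC in Dij.
  move: (di _ Dij) (dj _ Dij) => /= {}di {}dj.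
  set s := nsq (u - u') + _ in di dj *.
  have sE : s = (rpart '[u, u - u'] + rpart '[v, v - v'] - rpart (c - c')) -
                (rpart '[u', u - u'] + rpart '[v', v - v'] - rpart (c - c')).
    by rewrite /s /nsq !dotDl !rpartD !dotNl !rpartN; ring.
  have s0 : 0 <= s by rewrite addr_ge0// nsq_ge0.
  by apply: le_of_sqr_sub sE di dj; rewrite ?invr_ge0.
have invS_small (e : R) : 0 < e ->
    exists N, forall n, (N <= n)%N -> n.+1%:R^-1 < e.
  by move=> e0; have [N _ Ne] := near_infty_natSinv_lt (PosNum e0); exists N.
have p_small (e : R) : 0 < e -> exists N, forall i j, (N <= i)%N -> (N <= j)%N ->
    nsq ((p_ i).1.1 - (p_ j).1.1) + nsq ((p_ i).1.2 - (p_ j).1.2) < e.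
  move=> e0; have e4 : 0 < e / 4 by rewrite divr_gt0.
  have [N Ne] := invS_small _ e4.
  exists N => i j /Ne ie /Ne je; apply: le_lt_trans (p_cauchy i j) _.
  have -> : e = 2 * (e / 4 + e / 4) by field.
  by rewrite ltr_pM2l// ltrD.
have [x xp] : exists x, nsq_cvg (fun n => (p_ n).1.1) x.
  apply: nsq_cauchy_cvg => e /p_small[N Ne]; exists N => i j Ni Nj.
  by apply: le_lt_trans (Ne i j Ni Nj); rewrite lerDl nsq_ge0.
have [w wp] : exists w, nsq_cvg (fun n => (p_ n).1.2) w.
  apply: nsq_cauchy_cvg => e /p_small[N Ne]; exists N => i j Ni Nj.
  by apply: le_lt_trans (Ne i j Ni Nj); rewrite lerDr nsq_ge0.
have p_cvg (e : R) : 0 < e -> exists N, forall n, (N <= n)%N ->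
    nsq ((p_ n).1.1 - x) + nsq ((p_ n).1.2 - w) < e.
  move=> e0; have e2 : 0 < e / 2 by rewrite divr_gt0.
  have [[N Nx] [M Mw]] := (xp _ e2, wp _ e2).
  exists (maxn N M) => n; rewrite geq_max => /andP[/Nx nx /Mw nw]; lra.
exists x, w; split.
  move=> e /p_cvg[N /(_ N (leqnn N))]; have [] := p_min N.
  by case: (p_ N) => -[u v] c Dp _ pe; exists u, v, c.
suff rpart_eq u v c : D (u, v, c) -> rpart ('[u, x] + '[v, w] - c) = 0.
  move=> u v c Duvc; apply/eqP; rewrite -subr_eq0; apply/eqP/rpart_eq0 => a.
  have := D_lin a Duvc D0; rewrite !addr0 => /rpart_eq.
  by rewrite !dotZl -mulrDr -mulrBr.
move=> Duvc; apply/eqP; rewrite -sqrf_eq0 eq_le sqr_ge0 andbT.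
apply/ler_addgt0Pr => e e0; rewrite add0r.
set s : R := nsq u + nsq v; have s0 : 0 <= s by rewrite addr_ge0// nsq_ge0.
have s6 : 0 < 6 * (s + 1) by rewrite mulr_gt0// ltr_wpDl.
have e's : 0 < e / (6 * (s + 1)) by rewrite divr_gt0.
have [N Ne] := p_cvg _ e's; have [M Me] := invS_small _ e's.
have {}Me := Me _ (leq_maxr N M); have {Ne} := Ne _ (leq_maxl N M).
have := p_defect (maxn N M) _ Duvc; rewrite /defect /=.
case: (p_ _) => -[u' v'] c' /= pd pe.
have xd := sqr_rpart_dot_le (u' - x) u; have wd := sqr_rpart_dot_le (v' - w) v.
(* The defect at a late term of the sequence, minus the errors made in replacing [(x, w)] by that
   term. *)
have -> : rpart ('[u, x] + '[v, w] - c) = rpart '[u', u] + rpart '[v', v] - rpart c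
    - rpart '[u' - x, u] - rpart '[v' - w, v].
  rewrite !dotDl !rpartD !dotNl !rpartN.
  by rewrite ['[u, x]]dotC ['[v, w]]dotC !rpart_sconj; ring.
have -> : e = 6 * (e / (6 * (s + 1))) * (s + 1).
  by field; rewrite gt_eqF// ltr_wpDl.
apply: le_trans (sqr_sub3_le _ _ _) _; rewrite -/s in pd.
by apply: mul3_sum_le pd xd wd (ltW Me) (ltW pe) => //; exact: nsq_ge0.
Qed.
End Riesz.

(** * Graphs as subspaces of a product space *)

Section Graph.
Context {R : realType} {k : scalar_kind} {U V : hilbertType R k}.
Local Notation K := (Defs.scalar R k).
Implicit Types (A B : set (U * V)).

Definition graph_subspace A :=
  A (0, 0) /\ forall (a : K) u v u' v', A (u, v) -> A (u', v') ->
    A (a *: u + u', a *: v + v').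

(** Closedness in the product norm, in the form in which [riesz_closure] supplies approximations. *)
Definition graph_closed A := forall x w,
  (forall e : R, 0 < e -> exists u v, A (u, v) /\ nsq (u - x) + nsq (v - w) < e) ->
  A (x, w).

Lemma graph_subspaceB A u v u' v' : graph_subspace A ->
  A (u, v) -> A (u', v') -> A (u - u', v - v').
Proof.
move=> [_ Alin] Auv Auv'; have := Alin (-1) _ _ _ _ Auv' Auv.
by rewrite !scaleN1r ![- _ + _]addrC.
Qed.

End Graph.

(** * Adjoint relations and dense subspaces *)

Section Adjoint.
Context {R : realType} {k : scalar_kind} {U V : hilbertType R k}.
Local Notation K := (Defs.scalar R k).
Implicit Types (A B : set (U * V)).

Lemma adjoint_subspace A : graph_subspace (adjoint A).
Proof.
split=> [u v _|a v u v' u' /= vu vu' x y Axy] /=; first by rewrite !dot0r.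
by rewrite !dotDr !dotZr (vu _ _ Axy) (vu' _ _ Axy).
Qed.

Lemma adjoint_anti A B : A `<=` B -> adjoint B `<=` adjoint A.
Proof. by move=> AB p Bp u v /AB; exact: Bp. Qed.

Lemma adjoint_functional A v u u' : densely_defined A ->
  adjoint A (v, u) -> adjoint A (v, u') -> u = u'.
Proof.
move=> Adense vu vu'; apply/eqP; rewrite -subr_eq0; apply/eqP.
apply: (dense_ortho_eq0 Adense) => _ [[x y] Axy <-] /=.
by rewrite dotDr dotNr -(vu _ _ Axy) -(vu' _ _ Axy) subrr.
Qed.

Lemma adjoint_closed A : graph_closed (adjoint A).
Proof.
move=> x w xw u v Auv /=; apply/eqP; rewrite -subr_eq0; apply/eqP/rpart_eq0 => a.
rewrite mulrBr -!dotZl.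
(* [A] is an arbitrary set and may not contain the scaled pair; only its pairing with [adjoint A] is
   kept. *)
have {}Auv y t : adjoint A (y, t) -> '[a *: v, y] = '[a *: u, t].
  by move=> /(_ _ _ Auv) /= yt; rewrite !dotZl yt.
move: (a *: u) (a *: v) Auv => {a}u {}v Auv.
apply/eqP; rewrite -sqrf_eq0 eq_le sqr_ge0 andbT.
apply/ler_addgt0Pr => e e0; rewrite add0r.
set s : R := nsq v + nsq u; have s0 : 0 <= s by rewrite addr_ge0// nsq_ge0.
have s6 : 0 < 6 * (s + 1) by rewrite mulr_gt0// ltr_wpDl.
have e's : 0 < e / (6 * (s + 1)) by rewrite divr_gt0.
have [y [t [/Auv yt xye]]] := xw _ e's.
have xd := sqr_rpart_dot_le (y - x) v; have wd := sqr_rpart_dot_le (t - w) u.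
(* The leading 0 stands for ['[v, y] - '[u, t]] and gives the expression the three-term shape of
   [sqr_sub3_le]. *)
have -> : rpart ('[v, x] - '[u, w]) = 0 - rpart '[y - x, v] - - rpart '[t - w, u].
  rewrite -rpart_sconj -[in RHS]rpart_sconj -[in X in _ = _ - - X]rpart_sconj.
  by rewrite -!dotC !dotDr !rpartD !dotNr !rpartN yt rpart_sconj rpartD rpartN; ring.
have -> : e = 6 * (e / (6 * (s + 1))) * (s + 1).
  by field; rewrite gt_eqF// ltr_wpDl.
apply: le_trans (sqr_sub3_le _ _ _) _; rewrite sqrrN.
apply: (@mul3_sum_le _ _ _ _ _ _ _ _ _ 0) xd wd (ltW e's) (ltW xye) => //;
  rewrite ?nsq_ge0//.
by rewrite expr0n mul0r.
Qed.


End Adjoint.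

Lemma sub_adjointK {R : realType} {k : scalar_kind} {U V : hilbertType R k}
  (A : set (U * V)) : A `<=` adjoint (adjoint A).
Proof. by move=> [u v] Auv y z /= /(_ _ _ Auv) /= yz; rewrite dotC -yz -dotC. Qed.

Lemma adjoint_adjointK {R : realType} {k : scalar_kind} {U V : hilbertType R k}
  (A : set (U * V)) : adjoint (adjoint (adjoint A)) = adjoint A.
Proof. by apply/seteqP; split; [exact/adjoint_anti/sub_adjointK|exact: sub_adjointK]. Qed.

Lemma sqr_add_le_mul (R : realFieldType) (x y a b c d : R) :
  0 <= a -> 0 <= b -> 0 <= c -> 0 <= d -> x ^+ 2 <= a * c -> y ^+ 2 <= b * d ->
  (x + y) ^+ 2 <= 2 * (c + d) * (a + b).
Proof.
move=> a0 b0 c0 d0 xac ybd; have := sqr_ge0 (x - y).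
have := mulr_ge0 a0 d0; have := mulr_ge0 b0 c0.
by nra.
Qed.

(** Represent ['[y, g]] on [D] by a vector [x] in the closure of [D]: then [g - x] is orthogonal to
    [D], so [g = x]. The second component of the triples is frozen at 0. *)
Lemma ortho_eq0_dense {R : realType} {k : scalar_kind} {H : hilbertType R k}
    (D : set H) : D 0 ->
  (forall (a : Defs.scalar R k) x y, D x -> D y -> D (a *: x + y)) ->
  (forall x, (forall y, D y -> '[y, x] = 0) -> x = 0) -> dense D.
Proof.
move=> D0 Dlin Dortho; apply/dense_nsqP => g e e0.
pose D' : set (H * H * Defs.scalar R k) :=
  [set p | [/\ D p.1.1, p.1.2 = 0 & p.2 = '[p.1.1, g]]].
have D'0 : D' (0, 0, 0) by split => //=; rewrite dot0l.
have D'lin (a : Defs.scalar R k) y z c y' z' c' : D' (y, z, c) -> D' (y', z', c') ->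
    D' (a *: y + y', a *: z + z', a * c + c').
  move=> [/= Dy -> ->] [/= Dy' -> ->]; split => /=; first exact: Dlin.
    by rewrite scaler0 addr0.
  by rewrite !dotDl !dotZl.
have [||x [w [xw xwE]]] := riesz_closure (C := nsq g) D'0 D'lin; first exact: nsq_ge0.
  move=> y z c [/= Dy -> ->]; rewrite [nsq 0]/nsq dot0l rpart0 addr0 mulrC.
  exact: sqr_rpart_dot_le.
suff -> : g = x.
  have [y [z [c [[/= Dy _ _] yx]]]] := xw e e0; exists y => //.
  by rewrite -nsqN opprB; apply: le_lt_trans yx; rewrite lerDl nsq_ge0.
apply/eqP; rewrite -subr_eq0; apply/eqP/Dortho => y Dy.
have /xwE : D' (y, 0, '[y, g]) by [].
by rewrite dot0l addr0 dotDr dotNr => ->; rewrite subrr.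
Qed.

(** * Von Neumann's theorem: [B^* B] is self-adjoint for closed densely defined [B] *)

Section AdjointComp.
Context {R : realType} {k : scalar_kind} {U V : hilbertType R k}.
Context {B : set (U * V)}.
Hypotheses (B_subspace : graph_subspace B) (B_closed : graph_closed B).

(** The pair [(x, w)] is the orthogonal projection of [(g, u)] onto the graph: it represents on [B]
    the functional given by pairing with [(g, u)]. *)
Lemma graph_projection g u : exists x w, B (x, w) /\
  forall y z, B (y, z) -> '[y, x] + '[z, w] = '[y, g] + '[z, u].
Proof.
pose D : set (U * V * Defs.scalar R k) :=
  [set p | B p.1 /\ p.2 = '[p.1.1, g] + '[p.1.2, u]].
have D0 : D (0, 0, 0) by split; [exact: B_subspace.1|rewrite /= !dot0l addr0].
have Dlin (a : Defs.scalar R k) y z c y' z' c' : D (y, z, c) -> D (y', z', c') ->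
    D (a *: y + y', a *: z + z', a * c + c').
  move=> [/= Byz ->] [/= Byz' ->]; split; first exact: B_subspace.2.
  by rewrite /= !dotDl !dotZl mulrDr addrACA.
have [|y z c [_ /= ->]|x [w [xw xwE]]] := riesz_closure (C := 2 * (nsq g + nsq u)) D0 Dlin.
- by rewrite mulr_ge0// addr_ge0// nsq_ge0.
- by rewrite rpartD; apply: sqr_add_le_mul; rewrite ?nsq_ge0// sqr_rpart_dot_le.
exists x, w; split=> [|y z Byz]; last by apply: xwE; split.
by apply: B_closed => e /xw[y [z [c [[/= Byz _] yze]]]]; exists y, z.
Qed.

Local Notation S := (adjoint B \; B)%relation.

(** Surjectivity of [I + S]: if [(x, w)] is the projection of [(g, 0)] onto the graph of [B],
    orthogonality of the residual says that [B^*] maps [w] to [g - x]. *)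
Lemma adjoint_comp_resolvent g : exists x, S (x, g - x).
Proof.
have [x [w [Bxw xwE]]] := graph_projection g 0; exists x; exists w => // y z /xwE /=.
by rewrite dot0r addr0 dotDr dotNr => <-; rewrite addrC addKr.
Qed.

Hypothesis B_functional : forall u v v', B (u, v) -> B (u, v') -> v = v'.
Hypothesis B_dense : densely_defined B.

Lemma adjoint_comp_linear : linear_operator S.
Proof.
split.
- by exists 0; [exact: B_subspace.1|exact: (adjoint_subspace B).1].
- move=> a [f Sf] [g Sg] [/= x fx xSf] [/= y gy ySg]; exists (a *: x + y) => /=.
    exact: B_subspace.2.
  exact: (adjoint_subspace B).2.
move=> u v v' [/= x ux xv] [/= x' ux' xv'].
apply: (adjoint_functional B_dense) xv _.
by rewrite (B_functional ux ux').
Qed.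

Lemma adjoint_comp_symmetric : Defs.symmetric S.
Proof.
move=> f Sf g Sg [/= x fx xSf] [/= y gy ySg].
by rewrite -(ySg _ _ fx) dotC -(xSf _ _ gy) -dotC.
Qed.

Lemma adjoint_comp_positive : positive S.
Proof.
split=> [|f Sf [/= x fx xSf]]; first exact: adjoint_comp_symmetric.
by rewrite dotC -(xSf _ _ fx) -dotC -hdot_norm exprn_ge0.
Qed.

(** Let [g] be orthogonal to the domain and [(I + S) x = g]. Then [0 <= '[S x, x] = '[g - x, x] = -
    '[x, x]], so [x = 0] and [g = S 0 = 0]. *)
Lemma adjoint_comp_dense : densely_defined S.
Proof.
have [S0 Slin Sfun] := adjoint_comp_linear.
apply: ortho_eq0_dense.
- by exists (0, 0).
- move=> a _ _ [p Sp <-] [q Sq <-].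
  by exists (a *: p.1 + q.1, a *: p.2 + q.2) => //; exact: Slin.
move=> g Sg; have [x Sx] := adjoint_comp_resolvent g.
have := adjoint_comp_positive.2 _ _ Sx; rewrite dotDl dotNl dotC.
rewrite (Sg x) ?dotxx; last by exists (x, g - x).
have -> : sconj 0 = 0 :> Defs.scalar R k by rewrite -of_real0 sconj_of_real.
rewrite add0r oppr_ge0 -of_real0 ler_of_real => x0.
have {}x0 : x = 0 by apply/nsq_eq0/le_anti; rewrite x0 nsq_ge0.
by move: Sx; rewrite x0 subr0 => /Sfun; apply.
Qed.

(** For [(g, v)] in the adjoint, solve [(I + S) x = g + v]. By symmetry [g - x] is orthogonal to the
    range of [I + S], which is the whole space and so contains [g - x]. *)
Lemma adjoint_comp_self_adjoint : self_adjoint S.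
Proof.
have Slinear := adjoint_comp_linear.
split; first exact: adjoint_comp_dense.
apply/seteqP; split=> [[g v] gv|[g v] Sgv f Sf /adjoint_comp_symmetric]; last exact.
have [x Sx] := adjoint_comp_resolvent (g + v).
suff gx : g = x by move: Sx; rewrite -gx addrAC subrr add0r.
apply/eqP; rewrite -subr_eq0; apply/eqP; set z := g - x.
have [f Sf] := adjoint_comp_resolvent z.
have fg := gv _ _ Sf; have fx := adjoint_comp_symmetric Sf Sx.
have : '[z - f, z] = - '[f, z].
  rewrite {2}/z dotDr dotNr fg fx -!dotNr -dotDr; congr '[_, _].
  by rewrite [RHS]opprB opprB addrCA opprD [- g - v]addrC addNKr.
by rewrite dotDl dotNl -[RHS]add0r => /addIr zz; apply: nsq_eq0; rewrite /nsq zz rpart0.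
Qed.
End AdjointComp.

(** Von Neumann's theorem for [B = A^*]. Both extensions are instances: [A = J] for Krein-von
    Neumann, [A = Q^*] for Friedrichs. *)
Lemma adjoint_comp_extension {R : realType} {k : scalar_kind} {U V : hilbertType R k}
    (A : set (U * V)) (T : set (V * V)) :
  densely_defined A -> densely_defined (adjoint A) ->
  T `<=` (adjoint (adjoint A) \; adjoint A)%relation ->
  positive_self_adjoint_extension T (adjoint (adjoint A) \; adjoint A)%relation.
Proof.
move=> A_dense A'_dense TA.
have A'_fun v u u' := @adjoint_functional _ _ _ _ A v u u' A_dense.
split=> //.
- exact: adjoint_comp_linear (adjoint_subspace A) A'_fun A'_dense.
- exact: adjoint_comp_positive.
- exact: adjoint_comp_self_adjoint (adjoint_subspace A) (@adjoint_closed _ _ _ _ A)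
    A'_fun A'_dense.
Qed.

(** Turns a bound on the unit ball of a quadratic form into a homogeneous one. The slack
    [d / (C + 1)] added to [s] before inverting covers [s = 0] and costs at most [d]. *)
Lemma le_mul_of_scaled (R : rcfType) (C s b : R) : 0 <= C -> 0 <= s ->
  (forall t, t ^+ 2 * s <= 1 -> t ^+ 2 * b <= C) -> b <= C * s.
Proof.
move=> C0 s0 bC; apply/ler_addgt0Pr => d d0.
have C1 : 0 < C + 1 by rewrite ltr_wpDl.
have se0 : 0 < s + d / (C + 1) by rewrite ltr_wpDl// divr_gt0.
have := bC (Num.sqrt (s + d / (C + 1))^-1).
rewrite sqr_sqrtr ?invr_ge0 ?(ltW se0)// ![_^-1 * _]mulrC !ler_pdivrMr// mul1r.
rewrite lerDl divr_ge0 ?(ltW d0) ?(ltW C1)// => /(_ isT) /le_trans; apply.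
rewrite mulrDr lerD2l mulrCA ler_piMr ?(ltW d0)//.
by rewrite ler_pdivrMr// mul1r lerDl.
Qed.

(** * The Krein-von Neumann and Friedrichs extensions of [T] *)

Section Extensions.
Context {R : realType} {k : scalar_kind} {H E : hilbertType R k}.
Context {T : set (H * H)} {j : H -> E}.
Hypotheses (T_linear : linear_operator T) (T_dense : densely_defined T).
Hypotheses (T_positive : positive T) (E_completion : energy_completion T j).
Local Notation K := (Defs.scalar R k).
Local Notation J := (J_ T j).
Local Notation Q := (Q_ T j).

Let T_symmetric : Defs.symmetric T := T_positive.1.

Let j_linear (a : K) f Tf g Tg : T (f, Tf) -> T (g, Tg) ->
  j (a *: Tf + Tg) = a *: j Tf + j Tg.
Proof.
by case: E_completion => j_lin _ _ Tfg Tgg; apply: j_lin; [exists (f, Tf)|exists (g, Tg)].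
Qed.

Let dot_j f Tf g Tg : T (f, Tf) -> T (g, Tg) -> '[j Tf, j Tg] = '[Tf, g].
Proof. by case: E_completion => _ jE _; exact: jE. Qed.

Let nsq_j f Tf : T (f, Tf) -> nsq (j Tf) = rpart '[Tf, f].
Proof. by move=> Tff; rewrite /nsq (dot_j Tff Tff). Qed.

Lemma adjoint_JP g u :
  adjoint J (g, u) <-> forall h Th, T (h, Th) -> '[Th, g] = '[j Th, u].
Proof.
split=> [gu h Th Thh|gu _ _ [y [[h Th] Thh <-] [<- <-]]]; last exact: gu Thh.
by apply: gu; exists Th => //; exists (h, Th).
Qed.

Lemma adjoint_QP u g :
  adjoint Q (u, g) <-> forall h Th, T (h, Th) -> '[j Th, u] = '[h, g].
Proof.
split=> [ug h Th Thh|ug _ _ [[h Th] Thh [<- <-]]]; last exact: ug Thh.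
by apply: ug; exists (h, Th).
Qed.

Lemma sub_adjoint_J f Tf : T (f, Tf) -> adjoint J (f, j Tf).
Proof. by move=> Tff; apply/adjoint_JP => h Th Thh; rewrite (dot_j Thh Tff). Qed.

Lemma sub_adjoint_Q f Tf : T (f, Tf) -> adjoint Q (j Tf, Tf).
Proof.
by move=> Tff; apply/adjoint_QP => h Th Thh; rewrite (dot_j Thh Tff) (T_symmetric Thh Tff).
Qed.

Lemma J_sub_adjoint_Q : J `<=` adjoint Q.
Proof. by move=> _ [_ [[f Tf] Tff <-] <-]; exact: sub_adjoint_Q Tff. Qed.

Lemma adjoint_adjoint_Q_sub : adjoint (adjoint Q) `<=` adjoint J.
Proof. exact: adjoint_anti J_sub_adjoint_Q. Qed.

Lemma dense_sub (F : hilbertType R k) (D D' : set F) : D `<=` D' -> dense D -> dense D'.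
Proof. by move=> DD' Dd O O0 oO; have [x [Ox /DD' Dx]] := Dd O O0 oO; exists x. Qed.

Lemma J_dense : densely_defined J.
Proof.
case: E_completion => _ _ jd; apply: dense_sub jd => _ [y Ty <-].
by exists (j y, y) => //; exists y.
Qed.

Lemma adjoint_J_dense : densely_defined (adjoint J).
Proof.
by apply: dense_sub T_dense => _ [[f Tf] Tff <-]; exists (f, j Tf) => //; exact: sub_adjoint_J.
Qed.

Lemma Q_dense : densely_defined Q.
Proof.
by apply: dense_sub T_dense => _ [[f Tf] Tff <-]; exists (f, j Tf) => //; exists (f, Tf).
Qed.

Lemma adjoint_Q_dense : densely_defined (adjoint Q).
Proof.
by apply: dense_sub J_dense => _ [p Jp <-]; exists p => //; exact: J_sub_adjoint_Q.
Qed.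

Lemma adjoint_adjoint_Q_dense : densely_defined (adjoint (adjoint Q)).
Proof.
by apply: dense_sub Q_dense => _ [p Qp <-]; exists p => //; exact: sub_adjointK.
Qed.

Lemma krein_von_neumann_extension :
  positive_self_adjoint_extension T (krein_von_neumann T j).
Proof.
apply: adjoint_comp_extension J_dense adjoint_J_dense _ => -[f Tf] Tff.
exists (j Tf); first exact: sub_adjoint_J.
by apply: sub_adjointK; exists Tf => //; exists (f, Tf).
Qed.

Lemma friedrichs_extension :
  positive_self_adjoint_extension T (friedrichs T j).
Proof.
(* Since [Q^*** = Q^*], this has the form [A^** A^*] with [A = Q^*]. *)
have -> : friedrichs T j =
    (adjoint (adjoint (adjoint Q)) \; adjoint (adjoint Q))%relation.
  by rewrite adjoint_adjointK.
apply: adjoint_comp_extension adjoint_Q_dense adjoint_adjoint_Q_dense _ => -[f Tf] Tff.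
exists (j Tf); first by apply: sub_adjointK; exists (f, Tf).
by rewrite adjoint_adjointK; exact: sub_adjoint_Q Tff.
Qed.

(** As [nsq (j Tf) = rpart '[Tf, f]], the hypothesis bounds the functional sending [j Tf] to
    ['[Tf, g]], and its Riesz representative in [E] is [J^* g]. *)
Lemma form_bounded_adjoint_J g C : 0 <= C ->
  (forall f Tf, T (f, Tf) -> rpart '[Tf, g] ^+ 2 <= C * rpart '[Tf, f]) ->
  exists u, adjoint J (g, u).
Proof.
move=> C0 gC; have [T0 Tlin _] := T_linear.
pose D : set (E * E * K) := [set p | exists f Tf,
  [/\ T (f, Tf), p.1.1 = j Tf, p.1.2 = 0 & p.2 = '[Tf, g]]].
have j0 : j 0 = 0 by apply: nsq_eq0; rewrite (nsq_j T0) dot0l rpart0.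
have D0 : D (0, 0, 0) by exists 0, 0; split; rewrite //= dot0l.
have Dlin (a : K) u v c u' v' c' : D (u, v, c) -> D (u', v', c') ->
    D (a *: u + u', a *: v + v', a * c + c').
  move=> [f [Tf [/= Tff -> -> ->]]] [h [Th [/= Thh -> -> ->]]].
  exists (a *: f + h), (a *: Tf + Th); split=> /=; first exact: (Tlin a _ _ Tff Thh).
  - by rewrite (j_linear a Tff Thh).
  - by rewrite scaler0 addr0.
  - by rewrite dotDl dotZl.
have Dbound u v c : D (u, v, c) -> rpart c ^+ 2 <= C * (nsq u + nsq v).
  move=> [f [Tf [/= Tff -> -> ->]]].
  by rewrite [nsq 0]/nsq dot0l rpart0 addr0 (nsq_j Tff) gC.
have [u [v [_ uD]]] := riesz_closure D0 Dlin C0 Dbound.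
exists u; apply/adjoint_JP => h Th Thh.
have /uD : D (j Th, 0, '[Th, g]) by exists h, Th.
by rewrite dot0l addr0 => ->.
Qed.

Lemma Dstar_adjoint_J g : Dstar T g -> exists u, adjoint J (g, u).
Proof.
rewrite /Dstar /=; set A := [set _ | _ in _] => A_fin.
have [C [C0 AC]] : exists C : R, 0 <= C /\ forall p, energy_ball T p -> sqmod '[p.2, g] <= C.
  have A_ub p : energy_ball T p -> ((sqmod '[p.2, g])%:E <= ereal_sup A)%E.
    by move=> Tp; apply: ereal_sup_ubound; exists p.
  (* A real supremum gives [C], made nonnegative by the absolute value; a supremum equal to [-oo]
     would contradict [A_ub], so any [C] serves. *)
  case: (ereal_sup A) A_fin A_ub => // [r _ A_ub|_ A_ub].
    exists `|r|; split=> // p /A_ub; rewrite lee_fin => /le_trans; apply.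
    exact: ler_norm.
  by exists 0; split=> // p /A_ub; rewrite leeNy_eq.
apply: (form_bounded_adjoint_J C0) => f Tf Tff.
apply: le_trans (sqr_rpart_le _) _.
have [T0 Tlin _] := T_linear.
apply: le_mul_of_scaled => //; first by rewrite -(nsq_j Tff) nsq_ge0.
move=> t tf; pose a : K := of_real t.
have Taf : T (a *: f, a *: Tf) by have := Tlin a _ _ Tff T0; rewrite /= !addr0.
have := AC (a *: f, a *: Tf); rewrite /= dotZl sqmodM sqmod_of_real; apply; split => //=.
rewrite dotZl dotZr mulrA sconj_of_real -(dot_j Tff Tff) dotxx (nsq_j Tff).
by rewrite -!of_realM -of_real1 ler_of_real -expr2.
Qed.

Lemma ker_Dstar_eq0 : krein_von_neumann T j = friedrichs T j ->
  ker_add1 (adjoint T) `&` Dstar T = [set 0].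
Proof.
move=> KF; apply/seteqP; split=> [g [[Ag gAg gAg0] /Dstar_adjoint_J[u gu]]|_ ->] /=.
  have {}gAg0 : Ag = - g by apply/eqP; rewrite -addr_eq0 addrC gAg0.
  (* From [T^* g = - g] and [u = J^* g] it follows that [Q^* u = - g]. *)
  have ug : adjoint Q (u, - g).
    apply/adjoint_QP => h Th Thh; move/adjoint_JP: gu => /(_ _ _ Thh) <-.
    by rewrite (gAg _ _ Thh) gAg0.
  have [h] := adjoint_comp_resolvent (adjoint_subspace (adjoint Q))
    (@adjoint_closed _ _ _ _ (adjoint Q)) g.
  rewrite adjoint_adjointK => Fh; have : krein_von_neumann T j (h, g - h) by rewrite KF.
  case: Fh => w /= hw wgh [w' /= hw' w'gh].
  (* The factorizations through [T_F] and [T_N] share their middle vector [w]. Pairing it with [u]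
     through [Q^*] gives [- '[g, h]], and through [J^**] gives ['[g, g - h]]. *)
  have ww' := adjoint_functional J_dense (adjoint_adjoint_Q_sub hw) hw'.
  have /= uw := hw _ _ ug.
  have /= := w'gh _ _ gu; rewrite -ww' -uw dotNl dotDr dotNr addrC.
  by rewrite -[LHS]addr0 => /addrI gg; apply: nsq_eq0; rewrite /nsq -gg rpart0.
split; first by exists 0; [exact: (adjoint_subspace T).1|rewrite addr0].
rewrite /Dstar /=; apply: le_lt_trans (ltry 0); apply: ge_ereal_sup => _ [p Tp <-].
by rewrite dot0r -of_real0 sqmod_of_real expr0n.
Qed.

(** If [T^* g = - g] and [J^* g = u], then ['[f, g] = - '[Tf, g] = - '[j Tf, u]]. On the energy ball
    its squared modulus is at most [nsq u], so a non-zero [g] would have a finite supremum. *)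
Lemma ker_adjoint_J_eq0 :
  (forall g : H, g != 0 -> ker_add1 (adjoint T) g ->
    ereal_sup [set (sqmod '[p.1, g])%:E | p in energy_ball T] = +oo%E) ->
  forall g u, ker_add1 (adjoint T) g -> adjoint J (g, u) -> g = 0.
Proof.
move=> T_sup g u gker gu; apply/eqP/negPn/negP => /T_sup/(_ gker).
case: gker => Ag gAg gAg0; have {}gAg0 : Ag = - g by apply/eqP; rewrite -addr_eq0 addrC gAg0.
apply/eqP; rewrite -ltey; apply: le_lt_trans (ltry (nsq u)).
apply: ge_ereal_sup => _ [[f Tf] [/= Tff Tf1] <-]; rewrite lee_fin.
have := gAg _ _ Tff; rewrite /= gAg0 dotNr => /eqP; rewrite eq_sym eqr_oppLR => /eqP ->.
rewrite sqmodN; move/adjoint_JP: gu => /(_ _ _ Tff) ->.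
apply: le_trans (sqmod_dot_le _ _) _; rewrite ler_piMl ?nsq_ge0//.
by rewrite -(@ler_of_real _ k) -dotxx (dot_j Tff Tff) of_real1.
Qed.

Lemma adjoint_adjoint_Q_eq :
  (forall g u, ker_add1 (adjoint T) g -> adjoint J (g, u) -> g = 0) ->
  adjoint (adjoint Q) = adjoint J.
Proof.
move=> ker0; apply/seteqP; split=> [|[g u] gu]; first exact: adjoint_adjoint_Q_sub.
have [x [w [xw xwE]]] := graph_projection (adjoint_subspace (adjoint Q))
  (@adjoint_closed _ _ _ _ (adjoint Q)) g u.
have gxuw : adjoint J (g - x, u - w).
  exact: graph_subspaceB (adjoint_subspace J) gu (adjoint_adjoint_Q_sub xw).
have gx : g - x = 0.
  apply: (ker0 _ _ _ gxuw); exists (- (g - x)); last by rewrite subrr.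
  move=> h Th Thh /=; move/adjoint_JP: gxuw => /(_ _ _ Thh) ->.
  (* Orthogonality of the residual to [(h, j Th)] reads ['[j Th, u - w] = - '[h, g - x]], which is
     the equation [T^* (g - x) = - (g - x)]. *)
  have /xwE : adjoint (adjoint Q) (h, j Th) by apply: sub_adjointK; exists (h, Th).
  rewrite opprB !dotDr !dotNr => /eqP; rewrite -subr_eq0 opprD addrACA.
  by rewrite addr_eq0 opprB => /eqP ->.
have uw : u - w = 0.
  move: gxuw; rewrite gx => /(adjoint_functional J_dense); apply.
  exact: (adjoint_subspace J).1.
by move/eqP: gx uw; rewrite subr_eq0 => /eqP -> /eqP; rewrite subr_eq0 => /eqP ->.
Qed.

Lemma extension_eq_friedrichs S : adjoint (adjoint Q) = adjoint J ->
  positive_self_adjoint_extension T S -> friedrichs T j = S.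
Proof.
move=> QJ [S_linear [S_sym S_pos] [_ S_self] TS].
have [_ _ [_ F_self] _] := friedrichs_extension.
have SF : S `<=` friedrichs T j.
  move=> [f Sf] Sff; have [u fu] : exists u, adjoint J (f, u).
    apply: (form_bounded_adjoint_J (rpart_ge0 (S_pos _ _ Sff))) => h Th /TS Thh.
    apply: quad_ge0_discr => [|t]; first exact/rpart_ge0/S_pos.
    have [_ S_lin _] := S_linear.
    (* Positivity of [S] at [t h + f] is the quadratic inequality behind Cauchy-Schwarz for its
       form; the resulting constant is [rpart '[Sf, f]]. *)
    have := rpart_ge0 (S_pos _ _ (S_lin (of_real t) _ _ Thh Sff)).
    rewrite /= !dotDl !dotDr !dotZl !dotZr sconj_of_real !rpartD !rpartZ.
    rewrite (S_sym _ _ _ _ Sff Thh).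
    by rewrite ['[f, Th]]dotC rpart_sconj; lra.
  exists u; first by rewrite QJ.
  apply/adjoint_QP => h Th Thh; move/adjoint_JP: fu => /(_ _ _ Thh) <-.
  exact: S_sym (TS _ Thh) Sff.
(* Taking adjoints reverses the inclusion of [S] in the Friedrichs extension. *)
apply/seteqP; split=> //; rewrite -F_self -[X in _ `<=` X]S_self; exact: adjoint_anti.
Qed.

End Extensions.

(** * The cycle of implications, with (i) stated both as uniqueness and as [T_N = T_F] *)

Theorem corollary5p2 (R : realType) (k : scalar_kind) (H : hilbertType R k)
    (T : set (H * H)) (T_linear : linear_operator T)
    (T_dense : densely_defined T) (T_positive : positive T)
    (E : hilbertType R k) (j : H -> E) (E_completion : energy_completion T j) :
  [<-> exists! S : set (H * H), positive_self_adjoint_extension T S;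
       krein_von_neumann T j = friedrichs T j;
       ker_add1 (adjoint T) `&` Dstar T = [set 0];
       forall g : H, g != 0 -> ker_add1 (adjoint T) g ->
         ereal_sup [set (sqmod '[p.1, g])%:E | p in energy_ball T] = +oo%E].
Proof.
have F_ext := friedrichs_extension T_dense T_positive E_completion.
tfae.
- move=> [S [_ S_uniq]].
  by rewrite -(S_uniq _ (krein_von_neumann_extension T_dense E_completion))
    (S_uniq _ F_ext).
- exact: ker_Dstar_eq0.
(* On the kernel of [I + T^*] one has ['[Tf, g] = - '[f, g]], so a finite supremum here would put
   [g] into [Dstar T]. *)
- move=> kerD g g0 gker; have [Ag gAg gAg0] := gker.
  have {}gAg0 : Ag = - g by apply/eqP; rewrite -addr_eq0 addrC gAg0.
  apply: contrapT => /eqP; rewrite -ltey => sup_fin; move/eqP: g0; apply.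
  suff : (ker_add1 (adjoint T) `&` Dstar T) g by rewrite kerD.
  split=> //; rewrite /Dstar /=; apply: le_lt_trans sup_fin.
  apply: ge_ereal_sup => _ [[f Tf] fB <-] /=.
  have /= -> := gAg _ _ fB.1; rewrite gAg0 dotNr sqmodN.
  by apply: ereal_sup_ubound; exists (f, Tf).
- move=> T_sup; exists (friedrichs T j); split=> // S.
  apply: extension_eq_friedrichs => //.
  exact/adjoint_adjoint_Q_eq/ker_adjoint_J_eq0.
Qed.
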